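(* Let $G$ be a (locally compact, second countable, Hausdorff) unimodular amenable group, and let $(U_j)$ be a weak F{\o}lner sequence with $U_j\subseteq U_{j+1}$ for all $j\in\mathbb N$ which satisfies the Tempelman condition. Then every bounded, additive process $F:\mathcal F(G)\to L^1(\Omega,Y)$ satisfies an $L^1$-maximality condition for $(U_j)$: there is a constant $\gamma>0$ such that for all $\lambda>0$ and every $M\in\mathbb N$, $$\mu\left(\left\{\omega\in\Omega:\ \sup_{j\ge M}\frac{\|F(U_j)(\omega)\|_Y}{|U_j|}>\lambda\right\}\right)\le\frac{\gamma}{\lambda}\,\sup_{j\ge M}\frac{\|F^0(U_j)\|_{L^1(\Omega,\mathbb R)}}{|U_j|},$$ where $F^0$ is the associated dominating process of $F$.
   Context: $|A|$ is the Haar measure of a Borel set $A\subseteq G$; $\mathcal F(G)$ is the collection of Borel subsets of $G$ with compact closure. A weak F{\o}lner sequence is a sequence $(U_j)$ of non-empty compact sets with $\lim_j|U_j\triangle KU_j|/|U_j|=0$ for all non-empty compact $K\subseteq G$. It satisfies the Tempelman condition if there is $C>0$ with $\bigl|\bigcup_{i\le n}U_i^{-1}U_n\bigr|\le C|U_n|$ for all $n$. Setting for processes: $(\Omega,\mathcal F,\mu)$ is a $\sigma$-finite measure space with a measurable $\mu$-preserving action of $G$, $Y$ is a reflexive Banach space, $1\le p<\infty$ (here $p=1$), and $\{T_g\}_{g\in G}$ is a family of uniformly bounded linear operators acting weakly measurably on the Bochner space $L^p(\Omega,Y)$ (i.e. $\sup_g\|T_g\|<\infty$, $T_{\mathrm{id}}=\mathrm{Id}$,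 $T_{g_1}T_{g_2}=T_{g_1g_2}$, and $g\mapsto\langle T_gf,h\rangle$ is Borel measurable for all $f\in L^p(\Omega,Y)$, $h\in L^p(\Omega,Y)^*$) such that for some constant $\kappa\ge1$ and some measurable group homomorphism $\varphi:G\to G$, $$\kappa^{-1}\|f(\varphi(g)^{-1}\omega)\|_Y\le\|T_gf(\omega)\|_Y\le\kappa\|f(\varphi(g)^{-1}\omega)\|_Y$$ for all $g\in G$, $f\in L^p(\Omega,Y)$ and $\mu$-a.e. $\omega$. A bounded, additive process is a map $F:\mathcal F(G)\to L^p(\Omega,Y)$ with (i) $K:=\sup_{Q\in\mathcal F(G)}\|F(Q)\|_{L^p(\Omega,Y)}/|Q|<\infty$; (ii) $F(Q)=\sum_{k=1}^mF(Q_k)$ whenever $Q\in\mathcal F(G)$ is the disjoint union of $Q_1,\dots,Q_m\in\mathcal F(G)$; (iii) $T_gF(Q)=F(Qg^{-1})$ for all $Q\in\mathcal F(G)$, $g\in G$. The associated dominating process $F^0$ is defined by letting $F^0(Q)$ be the essential supremum of the functions $\omega\mapsto\sum_{k=1}^m\|F(Q_k)(\omega)\|_Y$ over all $m\in\mathbb N$ and all partitions $Q=\bigsqcup_{k=1}^mQ_k$ with $Q_k\in\mathcal F(G)$. *)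

(* Defs.v *)
From HB Require Import structures.
From mathcomp Require Import all_boot all_order all_algebra.
From mathcomp Require Import all_classical all_reals all_analysis.
From mathcomp Require Import measurable_realfun.

Set Implicit Arguments.
Unset Strict Implicit.
Unset Printing Implicit Defensive.

Import Order.TTheory GRing.Theory Num.Theory.
Import numFieldNormedType.Exports.

Local Open Scope classical_set_scope.
Local Open Scope ring_scope.

(* The distinguished point is only there because [measurableType] requires one;
   it is unrelated to the unit of the group. *)
HB.mixin Record isTopologicalGroup G of PointedTopological G & Group G := {
  mulg_continuous : continuous (fun z : G * G => (z.1 * z.2)%g) ;
  invg_continuous : continuous (fun x : G => (x^-1)%g)
}.

#[short(type="topologicalGroupType")]
HB.structure Definition TopologicalGroup :=
  {G of PointedTopological G & Group G & isTopologicalGroup G}.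

Notation borel T := (g_sigma_algebraType (@open T)).

(* Quotients of measures and norms below are taken in [\bar R], where
   [x / 0 = +oo] for [0 < x] and [0 / 0 = 0]. *)

Section groups.
Context {R : realType} {G : topologicalGroupType}.
Implicit Types (m : {measure set (borel G) -> \bar R}) (A B K Q : set G).

Definition mulset A B : set G := [set (a * b)%g | a in A & b in B].
Definition invset A : set G := [set (a^-1)%g | a in A].
Definition lshift_set (g : G) A : set G := [set (g * a)%g | a in A].
Definition rshift_set A (g : G) : set G := [set (a * g)%g | a in A].

Record left_haar_measure m : Prop := LeftHaarMeasure {
  haar_neq0 : (0 < m [set: G])%E ;
  haar_invariant : forall (g : G) (A : set (borel G)),
    measurable A -> m (lshift_set g A) = m A ;
  haar_compact : forall K, compact K -> (m K < +oo)%E ;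
  haar_outer_regular : forall A : set (borel G), measurable A ->
    m A = ereal_inf [set m O | O in [set O : set G | open O /\ A `<=` O]] ;
  haar_inner_regular : forall O : set G, open O ->
    m O = ereal_sup [set m K | K in [set K : set G | compact K /\ K `<=` O]]
}.

Definition unimodular m : Prop :=
  forall (g : G) (A : set (borel G)),
    measurable A -> m (rshift_set A g) = m A.

(* Every class in L^oo(G) has a bounded Borel representative. *)
Definition bounded_borel (f : G -> R) : Prop :=
  measurable_fun [set: borel G] (f : borel G -> R) /\
  exists C : R, forall x, `|f x| <= C.

(* A left-invariant mean on L^oo(G), as a functional on representatives. *)
Record left_invariant_mean m (L : (G -> R) -> R) : Prop := LeftInvariantMean {
  mean_ae : forall f f', bounded_borel f -> bounded_borel f' ->
    (f : borel G -> R) = f' %[ae m] -> L f = L f' ;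
  mean_linear : forall (a : R) f f', bounded_borel f -> bounded_borel f' ->
    L (fun x => a * f x + f' x) = a * L f + L f' ;
  mean_ge0 : forall f, bounded_borel f -> (forall x, 0 <= f x) -> 0 <= L f ;
  mean_cst1 : L (fun=> 1) = 1 ;
  mean_invariant : forall (g : G) f, bounded_borel f ->
    L (fun x => f (g^-1 * x)%g) = L f
}.

Definition amenable m : Prop := exists L, left_invariant_mean m L.

Definition weak_folner m (U : nat -> set G) : Prop :=
  (forall j, compact (U j) /\ U j !=set0) /\
  forall K, compact K -> K !=set0 ->
    (m (U j `+` mulset K (U j)) / m (U j))%E @[j --> \oo] --> 0%E.

Definition tempelman m (U : nat -> set G) : Prop :=
  exists2 C : R, 0 < C &
    forall n, (m (\bigcup_(i in [set i | (i <= n)%N]) mulset (invset (U i)) (U n))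
               <= C%:E * m (U n))%E.

Definition rel_compact_borel (Q : set G) : Prop :=
  measurable (Q : set (borel G)) /\ compact (closure Q).

Definition borel_partition (Q : set G) (n : nat) (P : 'I_n -> set G) : Prop :=
  [/\ forall i, rel_compact_borel (P i),
      trivIset [set: 'I_n] P & Q = \bigcup_i P i].

End groups.

(* Dual elements and functionals on the dual are plain functions restricted by
   these predicates. *)
Section reflexive.
Context {R : realType} (Y : normedModType R).

Definition in_dual (f : Y -> R) : Prop :=
  (forall (a : R) x y, f (a *: x + y) = a * f x + f y) /\
  exists C : R, forall x, `|f x| <= C * `|x|.

Definition dual_norm (f : Y -> R) : R :=
  sup [set `|f x| | x in [set x : Y | `|x| <= 1]].

Definition in_bidual (Phi : (Y -> R) -> R) : Prop :=
  (forall (a : R) f f', in_dual f -> in_dual f' ->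
     Phi (fun x => a * f x + f' x) = a * Phi f + Phi f') /\
  exists C : R, forall f, in_dual f -> `|Phi f| <= C * dual_norm f.

Definition reflexive_space : Prop :=
  forall Phi, in_bidual Phi ->
    exists y : Y, forall f, in_dual f -> Phi f = f y.

End reflexive.

(* L^1(Omega, Y) is handled through representatives: everywhere-defined strongly
   measurable functions, identified mu-almost everywhere. *)
Section bochner.
Context {R : realType} {d : measure_display} {Omega : measurableType d}
        {Y : normedModType R}.
Variable mu : {measure set Omega -> \bar R}.
Implicit Types (f : Omega -> Y).

Definition simple_function (s : Omega -> Y) : Prop :=
  finite_set (range s) /\ forall y, measurable (s @^-1` [set y]).

Definition strongly_measurable f : Prop :=
  exists2 s : nat -> Omega -> Y, forall n, simple_function (s n) &
    forall w, s n w @[n --> \oo] --> f w.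

Definition norm1 f : \bar R := (\int[mu]_w `|f w|%:E)%E.

Definition in_L1 f : Prop := strongly_measurable f /\ (norm1 f < +oo)%E.

Definition in_L1_dual (h : (Omega -> Y) -> R) : Prop :=
  [/\ forall f f', in_L1 f -> in_L1 f' -> f = f' %[ae mu] -> h f = h f',
      forall (a : R) f f', in_L1 f -> in_L1 f' ->
        h (fun w => a *: f w + f' w) = a * h f + h f' &
      exists C : R, forall f, in_L1 f -> (`|h f|%:E <= C%:E * norm1 f)%E].

Definition is_family_ess_sup (S : set (Omega -> \bar R)) (h : Omega -> \bar R) :
    Prop :=
  [/\ measurable_fun setT h,
      forall s, S s -> \forall w \ae mu, (s w <= h w)%E &
      forall h', measurable_fun setT h' ->
        (forall s, S s -> \forall w \ae mu, (s w <= h' w)%E) ->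
        \forall w \ae mu, (h w <= h' w)%E].

End bochner.

Section processes.
Context {R : realType} {G : topologicalGroupType} {d : measure_display}
        {Omega : measurableType d} {Y : completeNormedModType R}.
Variables (m : {measure set (borel G) -> \bar R})
          (mu : {measure set Omega -> \bar R}).

Record measure_preserving_action (act : G -> Omega -> Omega) : Prop :=
  MeasurePreservingAction {
  action_one : forall w, act 1%g w = w ;
  action_mul : forall g h w, act (g * h)%g w = act g (act h w) ;
  action_measurable :
    measurable_fun [set: borel G * Omega] (fun z => act z.1 z.2) ;
  action_preserving : forall g (A : set Omega), measurable A ->
    mu (act g @^-1` A) = mu A
}.

Record weakly_measurable_operators (T : G -> (Omega -> Y) -> (Omega -> Y)) :
    Prop := WeaklyMeasurableOperators {
  op_L1 : forall g f, in_L1 mu f -> in_L1 mu (T g f) ;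
  op_ae : forall g f f', in_L1 mu f -> in_L1 mu f' ->
    f = f' %[ae mu] -> T g f = T g f' %[ae mu] ;
  op_linear : forall g (a : R) f f', in_L1 mu f -> in_L1 mu f' ->
    T g (fun w => a *: f w + f' w) =
      (fun w => a *: T g f w + T g f' w) %[ae mu] ;
  op_bounded : exists C : R, forall g f, in_L1 mu f ->
    (norm1 mu (T g f) <= C%:E * norm1 mu f)%E ;
  op_one : forall f, in_L1 mu f -> T 1%g f = f %[ae mu] ;
  op_mul : forall g h f, in_L1 mu f -> T g (T h f) = T (g * h)%g f %[ae mu] ;
  op_measurable : forall f h, in_L1 mu f -> in_L1_dual mu h ->
    measurable_fun [set: borel G] (fun g : borel G => h (T g f))
}.

Definition norm_comparable (act : G -> Omega -> Omega)
    (T : G -> (Omega -> Y) -> (Omega -> Y)) : Prop :=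
  exists (kappa : R) (phi : {multiplicative G -> G}),
    [/\ 1 <= kappa,
        measurable_fun [set: borel G] (phi : borel G -> borel G) &
        forall g f, in_L1 mu f -> \forall w \ae mu,
          kappa^-1 * `|f (act (phi g)^-1%g w)| <= `|T g f w| /\
          `|T g f w| <= kappa * `|f (act (phi g)^-1%g w)|].

(* [F] is only constrained on relatively compact Borel sets. *)
Record bounded_additive_process (T : G -> (Omega -> Y) -> (Omega -> Y))
    (F : set G -> Omega -> Y) : Prop := BoundedAdditiveProcess {
  process_L1 : forall Q, rel_compact_borel Q -> in_L1 mu (F Q) ;
  process_bounded :
    (ereal_sup [set norm1 mu (F Q) / m Q | Q in rel_compact_borel]
      < +oo)%E ;
  process_additive : forall (Q : set G) n (P : 'I_n -> set G),
    rel_compact_borel Q -> borel_partition Q P ->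
    F Q = (fun w => \sum_(i < n) F (P i) w) %[ae mu] ;
  process_equivariant : forall (Q : set G) g, rel_compact_borel Q ->
    T g (F Q) = F (rshift_set Q g^-1%g) %[ae mu]
}.

Definition dominating_process (F : set G -> Omega -> Y)
    (F0 : set G -> Omega -> \bar R) : Prop :=
  forall Q, rel_compact_borel Q ->
    is_family_ess_sup mu
      [set s | exists n (P : 'I_n -> set G), borel_partition Q P /\
               s = (fun w => (\sum_(i < n) `|F (P i) w|)%:E)]
      (F0 Q).

End processes.

(* Main.v *)
Require Import Defs.
From mathcomp Require Import all_boot all_order all_algebra.
From mathcomp Require Import finmap.
From mathcomp Require Import all_classical all_reals all_analysis.
From mathcomp Require Import measurable_realfun ring.

Set Implicit Arguments.
Unset Strict Implicit.
Unset Printing Implicit Defensive.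

Import Order.TTheory GRing.Theory Num.Theory.
Import numFieldNormedType.Exports.

Local Open Scope classical_set_scope.
Local Open Scope ring_scope.

(** The proof transfers a Vitali covering argument from [G] to [Omega], with
    constant [gamma = 2 C kappa], where [C] is the Tempelman constant.

    Fix [lambda] and a window [M <= j <= N], and let [E] be the set of points
    at which [|F (U j)|] exceeds [lambda * m (U j)] for some [j] in the window.
    For each [g], the map [act (phi g^-1)^-1] preserves [mu], and for almost
    every [w] that it sends into [E] the equivariance of [F] and the norm
    comparison give a [j] with [kappa * |F (U j g) w| > lambda * m (U j)]; call
    such a [g] good for [w].  Averaging over the [g] in a compact set [V]
    expresses [m V * mu E] as the integral over [w] of the measure of a set of
    good [g].  For a fixed [w] this set is controlled by the covering lemma: a
    greedy choice extracts disjoint sets [U j g], and since the union of the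
    [U i^-1 U n] with [i <= n] has measure at most [C * m (U n)], the good [g]
    have measure at most a constant times the sum of the [m (U j)] over the
    chosen sets, hence of the [|F (U j g) w|] (lemmas [vitali_translates] and
    [transfer_inequality]).

    The values [F (U j g)] are only defined up to null sets depending on [g],
    so the average over [V] is discretised: [V] is cut into finitely many small
    pieces, each represented by a nearby point of [V].  Doubling the Tempelman
    constant absorbs the size of the pieces ([tempelman_thickening]), and only
    finitely many null sets occur.  The disjoint sets [U j g], which depend on
    [w], then all come from one finite family, and the atoms of the algebra it
    generates give a single majorant of the sums of the [|F (U j g) w|]
    ([packing_majorant]).  The atoms inside [V] form a partition of [V] and
    contribute at most the integral of [F0 V], and the others contribute at most
    the boundedness constant of [F] times the measure of [U N V] outside [V].

    Finally take [V = U n] and divide by [m (U n)]: the weak Folner condition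
    makes the second contribution negligible as [n] grows ([folner_step]), the
    first is at most the supremum on the right-hand side once [n >= M], and
    letting [N] grow gives the claim by continuity of [mu] from below. *)

(** * A finite Vitali selection *)

(** Repeatedly keep an element of maximal rank and discard everything that meets
    it: a discarded element then meets a kept one of at least its own rank. *)
Lemma greedy_subfamily (T : finType) (meets : rel T) (r : T -> nat)
    (A : {set T}) : reflexive meets -> symmetric meets ->
  exists S : {set T}, [/\ S \subset A,
    {in S &, forall x y, meets x y -> x = y} &
    {in A, forall x, exists2 y, y \in S & meets x y && (r x <= r y)%N}].
Proof.
move=> mxx mC; have [n] := ubnP #|A|; elim: n A => // n IH A leAn.
have [->|/set0Pn[a aA]] := eqVneq A finset.set0.
  by exists finset.set0; split=> [|x y|x]; rewrite ?sub0set// inE.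
have [b bA bmax] := @arg_maxnP _ a (mem A) r aA.
pose A' := finset (fun x => (x \in A) && ~~ meets x b).
have [|S [SA' Sdisj Scov]] := IH A'.
  rewrite -ltnS; apply: leq_trans leAn; rewrite ltnS proper_card//.
  apply/properP; split; first by apply/fintype.subsetP => x; rewrite inE => /andP[].
  by exists b => //; rewrite inE mxx andbF.
have notb x : x \in S -> ~~ meets x b.
  by move=> /(fintype.subsetP SA'); rewrite inE => /andP[].
exists (b |: S)%SET; split.
- rewrite finset.subUset finset.sub1set (bA : b \in A) /=.
  apply/fintype.subsetP => x /(fintype.subsetP SA').
  by rewrite inE => /andP[].
- move=> x y; rewrite !inE => /orP[/eqP->|xS] /orP[/eqP->|yS] //.
  + by rewrite mC (negbTE (notb _ yS)).
  + by rewrite (negbTE (notb _ xS)).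
  + exact: Sdisj.
- move=> x xA; have [mxb|mxb] := boolP (meets x b).
    by exists b; rewrite ?inE ?eqxx//= mxb; exact: bmax.
  have [|y yS xy] := Scov x; first by rewrite inE xA.
  by exists y; rewrite // !inE yS orbT.
Qed.

(** * Compact sets and translates in a topological group *)

Section topological_groups.
Context {G : topologicalGroupType}.
Implicit Types (A B K : set G) (g : G).

Lemma rshift_setE A g : rshift_set A g = (fun x => x * g^-1)%g @^-1` A.
Proof.
apply/seteqP; split=> [_ [a Aa <-]|x Ax] /=; first by rewrite mulgK.
by exists (x * g^-1)%g => //; rewrite mulgVK.
Qed.

Lemma rmul_continuous g : continuous (fun x : G => x * g)%g.
Proof.
move=> x.
apply: (@continuous_comp _ _ _ (fun y : G => (y, g)) (fun z => z.1 * z.2)%g).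
  by apply: cvg_pair; [exact: cvg_id|exact: cvg_cst].
exact: mulg_continuous.
Qed.

Lemma open_rshift A g : open A -> open (rshift_set A g).
Proof.
rewrite rshift_setE => oA; apply: open_comp => // x _; exact: rmul_continuous.
Qed.

Lemma compact_rshift A g : compact A -> compact (rshift_set A g).
Proof.
move=> cA; apply: (continuous_compact (f := fun x => x * g)%g) => //.
by apply: continuous_subspaceT; exact: rmul_continuous.
Qed.

Lemma compact_invset A : compact A -> compact (invset A).
Proof.
move=> cA; apply: (continuous_compact (f := fun x => x^-1)%g) => //.
by apply: continuous_subspaceT; exact: invg_continuous.
Qed.

Lemma compact_mulset A B : compact A -> compact B -> compact (mulset A B).
Proof.
move=> cA cB.
have -> : mulset A B = (fun z => z.1 * z.2)%g @` (A `*` B).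
  apply/seteqP; split=> [_ [a Aa [b Bb <-]]|_ [[a b] /= [Aa Bb] <-]].
    by exists (a, b).
  by exists a => //; exists b.
apply: continuous_compact; last exact: compact_setX.
by apply: continuous_subspaceT; exact: mulg_continuous.
Qed.

(** A tube lemma: continuity of multiplication at [(1, x)] gives a neighbourhood
    of [x] that some neighbourhood of the unit keeps inside [O], and compactness
    of [K] leaves finitely many neighbourhoods of the unit to intersect. *)
Lemma nbhs1_mulset_sub K O : compact K -> open O -> K `<=` O ->
  \forall b \near (1%g : G), forall x, K x -> O (b * x)%g.
Proof.
move=> /compact_near_coveringP cK oO KO.
apply: cK => x Kx.
have : nbhs (1 * x)%g O by rewrite mul1g; apply: open_nbhs_nbhs; split=> //; exact: KO.
move=> /(@mulg_continuous G (1%g, x)) [[P Q] /= [P1 Qx] PQ].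
by exists (Q, P) => //= -[y b] [Qy Pb]; exact: (PQ (b, y)).
Qed.

Lemma compact_translates_cover V (B : set G) : compact V -> open B -> B 1%g ->
  exists s : seq G, {in s, forall g, V g} /\
    V `<=` \bigcup_(i in `I_(size s)) rshift_set B (nth 1%g s i).
Proof.
rewrite compact_cover => cV oB B1.
have [|v Vv|D DV cov] := cV G V (fun g => rshift_set B g).
- by move=> g _; exact: open_rshift.
- by exists v => //; exists 1%g => //; rewrite mul1g.
exists (enum_fset D); split=> [g gD|v /cov[g gD Bgv]].
  by apply/set_mem; exact: DV.
exists (index g (enum_fset D)); first by rewrite /= index_mem.
by rewrite nth_index.
Qed.

End topological_groups.

(** * Haar measure of compact sets *)

(** The [g] such that the translate by [g] of some [U i] with [i <= n] meets
    [U n]; the Tempelman condition bounds its measure. *)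
Definition tempelman_hull {G : topologicalGroupType} (U : nat -> set G)
    (n : nat) : set G :=
  \bigcup_(i in [set i | (i <= n)%N]) mulset (invset (U i)) (U n).

Section relatively_compact_borel.
Context {R : realType} {G : topologicalGroupType}.
Hypothesis hG : hausdorff_space G.
Variable m : {measure set (borel G) -> \bar R}.
Hypothesis hm : left_haar_measure m.
Implicit Types (A K O Q V W : set G).

Lemma open_borel O : open O -> measurable (O : set (borel G)).
Proof. exact: sub_sigma_algebra. Qed.

Lemma compact_borel K : compact K -> measurable (K : set (borel G)).
Proof.
move=> /(compact_closed hG) cK; rewrite -[K]setCK; apply: measurableC.
by apply: open_borel; exact: closed_openC.
Qed.

Lemma compact_rcb K : compact K -> rel_compact_borel K.
Proof.
move=> cK; split; first exact: compact_borel.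
by rewrite -(closure_id K).1//; exact: compact_closed.
Qed.

Lemma sub_rcb W A : rel_compact_borel W -> measurable (A : set (borel G)) ->
  A `<=` W -> rel_compact_borel A.
Proof.
move=> [_ cW] mA AW; split => //; apply: subclosed_compact cW _.
  exact: closed_closure.
exact: closureS.
Qed.

Lemma rcb_fin_num Q : rel_compact_borel Q -> m Q \is a fin_num.
Proof.
move=> [mQ cQ]; rewrite ge0_fin_numE//; apply: le_lt_trans (haar_compact hm cQ).
apply: le_measure; rewrite ?inE//; first exact: compact_borel.
exact: subset_closure.
Qed.

(** Each hull is compact, so outer regularity encloses it in an open [O n] of
    measure at most [2 C m (U n)], and the tube lemma lets one neighbourhood [B]
    of the unit serve all [n <= N].  This slack is what allows the group to be
    discretised at scale [B] in the covering argument. *)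
Lemma tempelman_thickening (U : nat -> set G) (C : R) (N : nat) :
  (forall j, compact (U j)) -> 0 < C ->
  (forall n, (m (tempelman_hull U n) <= C%:E * m (U n))%E) ->
  exists B : set G, exists O : nat -> set G, [/\ open B, B 1%g &
    forall n, (n <= N)%N -> (0 < m (U n))%E ->
      [/\ open (O n), (m (O n) <= (2 * C)%:E * m (U n))%E &
          forall i b u v, (i <= n)%N -> B b -> U i u -> U n v ->
            O n (b * (u^-1 * v))%g]].
Proof.
move=> cU C0 hC.
pose D := tempelman_hull U.
have cD n : compact (D n).
  have -> : D n = \big[setU/set0]_(i < n.+1) mulset (invset (U i)) (U n).
    rewrite /D /tempelman_hull.
    by rewrite -(bigcup_mkord n.+1 (fun i => mulset (invset (U i)) (U n))).
  by apply: bigsetU_compact => i _; apply/compact_mulset/cU/compact_invset/cU.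
have DO n : exists O : set G, (0 < m (U n))%E ->
    [/\ open O, D n `<=` O & (m O <= (2 * C)%:E * m (U n))%E].
  have [mU0|mU0] := ltP 0%E (m (U n)); last by exists set0.
  have : (m (D n) < (2 * C)%:E * m (U n))%E.
    apply: le_lt_trans (hC n) _; rewrite lte_pmul2r//.
      by rewrite lte_fin ltr_pMl// ltr1n.
    exact: rcb_fin_num (compact_rcb (cU n)).
  rewrite (haar_outer_regular hm); last exact: compact_borel (cD n).
  move=> /ereal_inf_lt[_ [ O [oO DO] <-] /ltW mO].
  by exists O.
have [ O hO] := choice DO.
have nearB : \forall b \near (1%g : G), forall k : 'I_N.+1,
    (0 < m (U k))%E -> forall x, D k x -> O k (b * x)%g.
  apply: filter_forall => k.
  have [mU0|mU0] := ltP 0%E (m (U k)); last first.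
    by apply: nearW.
  have [oO DOk _] := hO k mU0.
  by apply: filterS (nbhs1_mulset_sub (cD k) oO DOk) => b + _.
exists (interior [set b | forall k : 'I_N.+1, (0 < m (U k))%E ->
  forall x, D k x -> O k (b * x)%g]), O.
split=> [||n nN mU0]; [exact: open_interior|by []|].
have [oO _ mO] := hO n mU0; split => // i b u v i_n /interior_subset hb Uu Uv.
apply: (hb (Ordinal (nN : (n < N.+1)%N))) => //.
exists i => //; exists (u^-1)%g; first by exists u.
by exists v.
Qed.

End relatively_compact_borel.

(** * Atoms of a finite family of sets *)

Section atoms.
Context {R : realType} {G : topologicalGroupType}.
Variables (T : finType) (W : set G) (Q : T -> set G).

(** The nonempty [atom A] are the atoms of the algebra of subsets of [W]
    generated by the [Q t]. *)
Definition atom (A : {set T}) : set G :=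
  [set x | W x /\ forall t, (t \in A) <-> Q t x].

Lemma trivIset_atom : trivIset setT atom.
Proof.
move=> A A' _ _ [x [[_ xA] [_ xA']]]; apply/setP => t.
by apply/idP/idP => [/xA/xA'|/xA'/xA].
Qed.

(** A subset of [W] on which membership depends only on the atom is a union of
    atoms. *)
Lemma bigcup_atom (P : {set T} -> Prop) (V : set G) : V `<=` W ->
  (forall A x, atom A x -> V x <-> P A) ->
  V = \bigcup_(A in P) atom A.
Proof.
move=> VW PV; apply/seteqP; split=> [x Vx|x [A PA xA]]; last exact/(PV A).
have xA : atom (finset (fun t => x \in Q t)) x.
  by split=> [|t]; [exact: VW|rewrite inE; split=> [/set_mem|Qx] //; exact: mem_set].
by exists (finset (fun t => x \in Q t)) => //; exact/(PV _ x).
Qed.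

Lemma measurable_atom A : measurable (W : set (borel G)) ->
  (forall t, measurable (Q t : set (borel G))) ->
  measurable (atom A : set (borel G)).
Proof.
move=> mW mQ.
have -> : atom A =
    W `&` \big[setI/setT]_(t : T) (if t \in A then Q t else ~` Q t).
  apply/seteqP; split=> x.
    move=> [Wx xA]; split=> //; rewrite -bigcap_seq => t _ /=.
    by case: ifPn => [/xA//|/negP tA Qx]; apply/tA/xA.
  move=> [Wx]; rewrite -bigcap_seq => xA; split=> // t.
  have /= := xA t (mem_index_enum t).
  by case: ifPn => // _ nQ; split.
apply: measurableI => //; apply: bigsetI_measurable => t _.
by case: ifP => _ //; exact: measurableC.
Qed.

End atoms.

(** * Measures and finite unions *)

Lemma fsume_finset {R : realType} (I : finType) (B : {set I})
    (f : I -> \bar R) :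
  (\sum_(i \in [set` B]) f i = \sum_(i in B) f i)%E.
Proof.
rewrite -[RHS]big_enum [RHS]fsbig_seq ?enum_uniq//.
suff -> : [set` B] = [set` enum B] by [].
by apply/seteqP; split=> i /=; rewrite mem_enum.
Qed.

Lemma measure_bigcup_finset {R : realType} d (T : measurableType d)
    (mu : {measure set T -> \bar R}) (I : finType) (B : {set I})
    (p : I -> set T) :
  trivIset setT p -> (forall i, measurable (p i)) ->
  mu (\bigcup_(i in [set` B]) p i) = (\sum_(i in B) mu (p i))%E.
Proof.
move=> tp mp; rewrite measure_fin_bigcup//; last exact: sub_trivIset tp.
exact: fsume_finset.
Qed.

Lemma measure_sub_bigcup_finset {R : realType} d (T : measurableType d)
    (mu : {measure set T -> \bar R}) (I : finType) (B : {set I})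
    (p : I -> set T) (A : set T) : measurable A ->
  {in B, forall i, measurable (p i)} ->
  A `<=` \bigcup_(i in [set` B]) p i -> (mu A <= \sum_(i in B) mu (p i))%E.
Proof.
move=> mA mp AB; apply: le_trans (content_sub_fsum mu _ _ mA AB) _ => //.
by rewrite fsume_finset.
Qed.

(** * Covering a compact set by translates *)

Section vitali.
Context {R : realType} {G : topologicalGroupType}.
Variables (m : {measure set (borel G) -> \bar R}) (U : nat -> set G).
Hypothesis hG : hausdorff_space G.
Hypothesis hm : left_haar_measure m.
Hypothesis hu : unimodular m.

(** The compact set [V] is cut into pieces of weight [v i],
    each contained in the translate by [g i] of a small neighbourhood of the
    unit.  An element [(i, j)] of [A] stands for the translate of [U j] by
    [g i]; the total weight of the pieces occurring in [A] is controlled by a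
    disjoint subfamily.  Indeed if [U j (g i)] meets [U n (g i')] with [j <= n],
    then [g i] lies in [U j^-1 U n (g i')], hence the [i]-th piece lies in the
    thickened hull of [U n] translated by [g i'], and translates have equal
    measure by unimodularity. *)
Lemma vitali_translates (C : R) (N : nat) (V : set G) :
  (forall j, compact (U j)) -> (forall j, U j !=set0) -> 0 < C ->
  (forall n, (m (tempelman_hull U n) <= C%:E * m (U n))%E) ->
  compact V ->
  exists k (g : 'I_k -> G) (v : 'I_k -> R), [/\
    forall i, V (g i), forall i, 0 <= v i, \sum_i v i = fine (m V) &
    forall A : {set 'I_k * 'I_N.+1}, (forall x, x \in A -> (0 < m (U x.2))%E) ->
      exists S : {set 'I_k * 'I_N.+1}, [/\ S \subset A,
        {in S &, forall x y : 'I_k * 'I_N.+1, rshift_set (U x.2) (g x.1) `&`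
                             rshift_set (U y.2) (g y.1) !=set0 -> x = y} &
        \sum_(i | [exists j, (i, j) \in A]) v i <=
          2 * C * \sum_(y in S) fine (m (U y.2))]].
Proof.
move=> cU U0 C0 hC cV.
have [B [ O [oB B1 hO]]] := tempelman_thickening hG hm N cU C0 hC.
have [s [sV Vs]] := compact_translates_cover cV oB B1.
pose g (i : 'I_(size s)) := nth 1%g s i.
pose Bg i := rshift_set B (nth 1%g s i).
pose P (i : 'I_(size s)) : set (borel G) := V `&` seqDU Bg i.
have mB i : measurable (Bg i : set (borel G)).
  by apply: open_borel; exact: open_rshift.
have mV : measurable (V : set (borel G)) by exact: compact_borel.
have mP i : measurable (P i).
  apply: measurableI => //; apply: measurableD; first exact: mB.
  by apply: bigsetU_measurable => j _; exact: mB.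
have tP : trivIset setT P.
  move=> i j _ _ [x [[_ xi] [_ xj]]]; apply: val_inj.
  by apply: (@trivIset_seqDU _ Bg) => //; exists x.
have VP : V = \bigcup_(i in [set` finset.setT]) P i.
  apply/seteqP; split=> [x Vx|x [i _ []]//].
  have [i] : (\bigcup_(i < size s) seqDU Bg i) x.
    by rewrite bigcup_mkord -bigsetU_seqDU -bigcup_mkord; exact: Vs.
  by move=> /= ilt Bx; exists (Ordinal ilt); rewrite //= inE.
have Pfin i : m (P i) \is a fin_num.
  by apply: (rcb_fin_num hG hm); apply: sub_rcb (compact_rcb hG cV) (mP i) _ => x [].
have Ufin j : m (U j) \is a fin_num by exact: rcb_fin_num (compact_rcb hG (cU j)).
have gV i : V (g i) by apply/sV/mem_nth.
exists (size s), g, (fun i => fine (m (P i))); split=> //.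
  rewrite VP measure_bigcup_finset// sum_fine//.
  by congr fine; apply: eq_bigl => i; rewrite inE.
move=> A mA.
pose Q (x : 'I_(size s) * 'I_N.+1) := rshift_set (U x.2) (g x.1).
pose meets : rel ('I_(size s) * 'I_N.+1) := fun x y => `[< Q x `&` Q y !=set0 >].
have meetsxx : reflexive meets.
  by move=> x; apply/asboolP; rewrite setIid; have [u] := U0 x.2;
    exists (u * g x.1)%g, u.
have meetsC : symmetric meets by move=> x y; rewrite /meets setIC.
have [S [SA Sdisj Scov]] := greedy_subfamily (fun x => val x.2) A meetsxx meetsC.
exists S; split=> // [x y xS yS xy|]; first by apply: Sdisj => //; exact/asboolP.
pose J := finset (fun i => [exists j, (i, j) \in A]).
rewrite (eq_bigl (fun i => i \in J)); last by move=> i; rewrite inE.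
have JS : \bigcup_(i in [set` J]) P i `<=`
    \bigcup_(y in [set` S]) rshift_set (O y.2) (g y.1).
  move=> x [i /=]; rewrite inE => /existsP[j ijA] [_ [Bgx _]].
  have [y yS /andP[/asboolP[z [[u Uu uz] [v Uv vz]]] /= jy]] := Scov _ ijA.
  exists y => //; have [b Bb bx] := Bgx.
  have [_ _ hOy] := hO y.2 (ltn_ord y.2) (mA _ (fintype.subsetP SA _ yS)).
  exists (b * (u^-1 * v))%g; first exact: hOy jy Bb Uu Uv.
  by rewrite -bx -!mulgA vz -uz mulKg.
have mO y : y \in S -> measurable (rshift_set (O y.2) (g y.1) : set (borel G)).
  move=> yS; apply: open_borel; apply: open_rshift.
  by have [] := hO y.2 (ltn_ord y.2) (mA _ (fintype.subsetP SA _ yS)).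
rewrite -lee_fin -sumEFin EFinM.
under eq_bigr do rewrite fineK//.
rewrite -measure_bigcup_finset//.
apply: (@le_trans _ _ (\sum_(y in S) m (rshift_set (O y.2) (g y.1)))%E).
  apply: measure_sub_bigcup_finset => //.
  by apply: fin_bigcup_measurable.
rewrite -sumEFin ge0_sume_distrr//.
apply: lee_sum => y yS; rewrite fineK//.
have [oO mOy _] := hO y.2 (ltn_ord y.2) (mA _ (fintype.subsetP SA _ yS)).
by rewrite hu//; exact: open_borel.
Qed.

End vitali.

(** * Additive processes on finite partitions *)

Lemma strongly_measurable_norm {R : realType} d (Omega : measurableType d)
    (Y : normedModType R) (f : Omega -> Y) :
  strongly_measurable f -> measurable_fun setT (fun w => `|f w|).
Proof.
move=> [s ss sf]; apply: (@measurable_fun_cvg _ _ _ _ (fun n w => `|s n w|)).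
  move=> n _ B mB; rewrite setTI; have [fs ms] := ss n.
  have -> : (fun w => `|s n w|) @^-1` B =
      \bigcup_(y in range (s n) `&` [set y | B `|y|]) (s n @^-1` [set y]).
    apply/seteqP; split=> [w Bw|w [y [_ By] /= swy]]; last by rewrite /= swy.
    by exists (s n w) => //; split=> //; exists w.
  by apply: fin_bigcup_measurable => //; exact: finite_setIl.
by move=> w _; apply: cvg_norm; exact: sf.
Qed.

Section process.
Context {R : realType} {G : topologicalGroupType} {d : measure_display}
        {Omega : measurableType d} {Y : completeNormedModType R}.
Variables (m : {measure set (borel G) -> \bar R})
          (mu : {measure set Omega -> \bar R})
          (T : G -> (Omega -> Y) -> (Omega -> Y))
          (F : set G -> Omega -> Y)
          (F0 : set G -> Omega -> \bar R).
Hypothesis hG : hausdorff_space G.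
Hypothesis hm : left_haar_measure m.
Hypothesis hF : bounded_additive_process m mu T F.
Hypothesis hF0 : dominating_process mu F F0.

Lemma process_norm_measurable Q : rel_compact_borel Q ->
  measurable_fun setT (fun w => `|F Q w|).
Proof. by move=> /(process_L1 hF)[/strongly_measurable_norm]. Qed.

(** Since [x / 0 = +oo] for [0 < x], finiteness of the supremum of the ratios
    also covers the sets of measure zero. *)
Lemma process_norm1_le : exists2 K : R, 0 <= K &
  forall Q, rel_compact_borel Q -> (norm1 mu (F Q) <= K%:E * m Q)%E.
Proof.
have := process_bounded hF; set s := ereal_sup _ => sy.
have ubs Q : rel_compact_borel Q -> (norm1 mu (F Q) / m Q <= s)%E.
  by move=> hQ; apply: ereal_sup_ubound; exists Q.
have n0 Q : (0 <= norm1 mu (F Q))%E by apply: integral_ge0.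
have rcb0 : rel_compact_borel (set0 : set G).
  by split=> //; rewrite closure0; exact: compact0.
have s0 : (0 <= s)%E.
  by apply: le_trans (ubs _ rcb0); rewrite mule_ge0// inve_ge0.
have sfin : s \is a fin_num by rewrite ge0_fin_numE.
exists (fine s) => [|Q hQ]; first exact: fine_ge0.
rewrite fineK//; have := ubs Q hQ.
have mQf := rcb_fin_num hG hm hQ.
have [mQ0|mQ0] := eqVneq (m Q) 0%E.
  rewrite mQ0 inve0 mule0 => nQs; rewrite leNgt; apply/negP => nQ.
  by move: nQs; rewrite gt0_muley// leye_eq => /eqP sE; rewrite sE in sy.
have mQgt : (0 < m Q)%E by rewrite lt0e mQ0 measure_ge0.
rewrite -(fineK mQf) inver gt_eqF ?fine_gt0 ?mQgt ?ltey_eq ?mQf//.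
by rewrite lee_pdivrMr// fine_gt0// mQgt ltey_eq mQf.
Qed.

Lemma process_set0 : F set0 = cst 0 %[ae mu].
Proof.
have rcb0 : rel_compact_borel (set0 : set G).
  by split=> //; rewrite closure0; exact: compact0.
(* The empty set is the disjoint union of no sets at all. *)
have part0 : borel_partition set0 (fun _ : 'I_0 => set0 : set G).
  by split=> [//|[]//|]; rewrite bigcup0.
by apply: filterS (process_additive hF rcb0 part0) => w /[apply]; rewrite big_ord0.
Qed.

Section finite_partition.
Variables (I : finType) (p : I -> set G) (B : {set I}).
Hypothesis rp : forall i, rel_compact_borel (p i).
Hypothesis tp : trivIset setT p.

Lemma borel_partition_enum :
  borel_partition (\bigcup_(i in [set` B]) p i)
    (fun k : 'I_#|B| => p (enum_val k)).
Proof.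
split=> [k|k k' _ _ kk'|]; first exact: rp.
  by apply: enum_val_inj; apply: tp kk'.
apply/seteqP; split=> [x [i iB pix]|x [k _ pkx]].
  by exists (enum_rank_in iB i) => //; rewrite enum_rankK_in.
by exists (enum_val k) => //; exact: enum_valP.
Qed.

Lemma process_finite_sum : rel_compact_borel (\bigcup_(i in [set` B]) p i) ->
  F (\bigcup_(i in [set` B]) p i) =
    (fun w => \sum_(i in B) F (p i) w) %[ae mu].
Proof.
move=> rB; have := process_additive hF rB borel_partition_enum.
apply: filterS => w h _; by rewrite h// [RHS]big_enum_val.
Qed.

Lemma sum_norm_le_dominating : rel_compact_borel (\bigcup_(i in [set` B]) p i) ->
  \forall w \ae mu, ((\sum_(i in B) `|F (p i) w|)%:E <=
    F0 (\bigcup_(i in [set` B]) p i) w)%E.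
Proof.
move=> rB; have [_ F0ub _] := hF0 rB.
have := F0ub (fun w => (\sum_(k < #|B|) `|F (p (enum_val k)) w|)%:E).
case=> [|N hN].
  by exists #|B|, (fun k => p (enum_val k)); split=> //; exact: borel_partition_enum.
exists N; move: hN => [? ? hN]; split=> // w h; apply: hN; move: h.
by rewrite /= big_enum_val.
Qed.

End finite_partition.
End process.

Section packing.
Context {R : realType} {G : topologicalGroupType} {d : measure_display}
        {Omega : measurableType d} {Y : completeNormedModType R}.
Variables (m : {measure set (borel G) -> \bar R})
          (mu : {measure set Omega -> \bar R})
          (T : G -> (Omega -> Y) -> (Omega -> Y))
          (F : set G -> Omega -> Y)
          (F0 : set G -> Omega -> \bar R).
Hypothesis hF : bounded_additive_process m mu T F.
Hypothesis hF0 : dominating_process mu F F0.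

(** The disjoint subfamily [S] may depend on [w], yet the majorant may not: [H]
    is the sum of the norms of [F] over all atoms generated by [V] and the
    [Q i].  By additivity each [|F (Q i)|] is at most the sum over the atoms
    inside [Q i], and an atom lies inside at most one member of a disjoint
    family.  The atoms inside [V] partition it, which is where the dominating
    process enters. *)
Lemma packing_majorant (K : R) (I : finType) (Q : I -> set G) (V W : set G) :
  0 <= K ->
  (forall A, rel_compact_borel A -> (norm1 mu (F A) <= K%:E * m A)%E) ->
  rel_compact_borel W -> measurable (V : set (borel G)) -> V `<=` W ->
  (forall i, measurable (Q i : set (borel G))) -> (forall i, Q i `<=` W) ->
  exists H : Omega -> R, [/\ measurable_fun setT H, forall w, 0 <= H w,
    (\int[mu]_w (H w)%:E <= \int[mu]_w `|F0 V w| + K%:E * m (W `\` V))%E &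
    \forall w \ae mu, forall S : {set I},
      {in S &, forall i j, Q i `&` Q j !=set0 -> i = j} ->
      \sum_(i in S) `|F (Q i) w| <= H w].
Proof.
move=> K0 FK rW mV VW mQ QW.
(* The index [None] adds [V] itself to the family. *)
pose Q' (o : option I) := if o is Some i then Q i else V.
have mQ' o : measurable (Q' o : set (borel G)) by case: o => [i|]; [exact: mQ|exact: mV].
have Q'W o : Q' o `<=` W by case: o => [i|] x; [exact: QW|exact: VW].
pose p := atom W Q'.
have mp A : measurable (p A : set (borel G)) by apply: measurable_atom => //; case: rW.
have rp A : rel_compact_borel (p A) by apply: sub_rcb rW _ _ => // x [].
have tp : trivIset setT p by exact: trivIset_atom.
pose at_ (o : option I) := finset (fun A : {set option I} => o \in A).
have Q'E o : Q' o = \bigcup_(A in [set` at_ o]) p A.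
  by apply: bigcup_atom => // A x [_ /(_ o) xA]; rewrite /= inE; apply: iff_sym.
have WVE : W `\` V = \bigcup_(A in [set` ~: at_ None]) p A.
  apply: bigcup_atom => [x []//|A x [Wx /(_ None) xA]]; rewrite /= !inE.
  split=> [[_ nVx]|/negP nA]; first by apply/negP => /xA.
  by split=> // Vx; apply/nA/xA.
pose f A w := `|F (p A) w|.
have f0 A w : 0 <= f A w by exact: normr_ge0.
have mf A : measurable_fun setT (f A) by exact: (process_norm_measurable hF (rp A)).
have mSf (B : {set {set option I}}) : measurable_fun setT (fun w => \sum_(A in B) f A w).
  rewrite (_ : (fun _ => _) = (fun w => \sum_(A <- enum B) f A w)).
    exact: measurable_sum.
  by apply/funext => w; rewrite big_enum.
have rQ' o : rel_compact_borel (Q' o) by apply: sub_rcb rW _ _.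
exists (fun w => \sum_A f A w); split.
- exact: measurable_sum.
- by move=> w; apply: sumr_ge0 => A _; exact: f0.
- have -> : (fun w => (\sum_A f A w)%:E) = (fun w =>
     (\sum_(A in at_ None) f A w)%:E + (\sum_(A in ~: at_ None) f A w)%:E)%E.
    apply/funext => w; rewrite -EFinD (bigID (mem (at_ None)))/=; congr (_ + _)%:E.
    by apply: eq_bigl => A; rewrite finset.in_setC.
  rewrite ge0_integralD//=; last 4 first.
  + by move=> w _; rewrite lee_fin; apply: sumr_ge0 => A _; exact: f0.
  + by apply/measurable_EFinP.
  + by move=> w _; rewrite lee_fin; apply: sumr_ge0 => A _; exact: f0.
  + by apply/measurable_EFinP.
  apply: leeD.
    have [mF0 _ _] := hF0 (rQ' None).
    apply: ae_ge0_le_integral => //.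
    + by move=> w _; rewrite lee_fin; apply: sumr_ge0 => A _; exact: f0.
    + by apply/measurable_EFinP.
    + exact: measurableT_comp.
    have := @sum_norm_le_dominating _ _ _ _ _ _ _ _ hF0 _ p (at_ None) rp tp.
    rewrite -(Q'E None) => /(_ (rQ' None)).
    by apply: filterS => w h _; apply: le_trans h (lee_abs _).
  under eq_integral do rewrite -sumEFin -big_enum/=.
  rewrite ge0_integral_sum//; last 2 first.
  + by move=> A; apply/measurable_EFinP.
  + by move=> A w _; rewrite lee_fin.
  rewrite big_enum/= WVE measure_bigcup_finset//.
  rewrite ge0_sume_distrr//; apply: lee_sum => A _; exact: FK.
- have : \forall w \ae mu, forall o, F (Q' o) w = \sum_(A in at_ o) F (p A) w.
    apply: filter_forall => o.
    have := @process_finite_sum _ _ _ _ _ _ _ _ _ hF _ p (at_ o) rp tp.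
    rewrite -(Q'E o) => /(_ (rQ' o)).
    by apply: filterS => w; exact.
  have : \forall w \ae mu, F set0 w = 0.
    by apply: filterS (process_set0 hF) => w; exact.
  apply: filterS2 => w F00 FQ S Sdisj.
  apply: (@le_trans _ _ (\sum_(i in S) \sum_(A in at_ (Some i)) f A w)).
    by apply: ler_sum => i _; rewrite (FQ (Some i)); exact: ler_norm_sum.
  rewrite (exchange_big_dep xpredT)//=; apply: ler_sum => A _.
  (* Empty atoms may belong to several disjoint sets; [F] vanishes there. *)
  have [pA0|/set0P[x [_ xA]]] := eqVneq (p A) set0.
    by rewrite big1 // => i _; rewrite /f pA0 F00 normr0.
  have [i /andP[iS iA]|noi] := pickP (fun i => (i \in S) && (A \in at_ (Some i))).
    rewrite (bigD1 i)/= ?iS// big1 ?addr0// => j /andP[/andP[jS jA] /eqP ji].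
    case: ji; apply: Sdisj => //; exists x; split.
      by move: jA; rewrite inE => /xA.
    by move: iA; rewrite inE => /xA.
  by rewrite big_pred0//.
Qed.

End packing.

(** * The transfer inequality *)

Section maximal.
Context {R : realType} {G : topologicalGroupType} {d : measure_display}
        {Omega : measurableType d} {Y : completeNormedModType R}.
Variables (m : {measure set (borel G) -> \bar R})
          (mu : {measure set Omega -> \bar R})
          (U : nat -> set G) (act : G -> Omega -> Omega)
          (T : G -> (Omega -> Y) -> (Omega -> Y))
          (F : set G -> Omega -> Y)
          (F0 : set G -> Omega -> \bar R).
Hypothesis hG : hausdorff_space G.
Hypothesis hm : left_haar_measure m.
Hypothesis hu : unimodular m.
Hypothesis cU : forall j, compact (U j).
Hypothesis U0 : forall j, U j !=set0.
Hypothesis ndU : {homo U : i j / (i <= j)%N >-> i `<=` j}.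
Hypothesis hact : measure_preserving_action mu act.
Hypothesis hF : bounded_additive_process m mu T F.
Hypothesis hF0 : dominating_process mu F F0.

Definition exceedance (lambda : R) (j : nat) : set Omega :=
  [set w | lambda * fine (m (U j)) < `|F (U j) w|].

Lemma measurable_exceedance lambda j : measurable (exceedance lambda j).
Proof.
rewrite -[exceedance _ _]setTI.
have /measurable_EFinP mF := process_norm_measurable hF (compact_rcb hG (@cU j)).
exact: (emeasurable_fun_o_infty measurableT mF (lambda * fine (m (U j)))%:E).
Qed.

Lemma measurable_act g : measurable_fun setT (act g).
Proof.
exact: (measurable_fun_pair2 (g : borel G) (action_measurable hact)).
Qed.

(** The operator [T g^-1] moves [F Q] to [F (Q g)] and is comparable to
    composition with the action of [(phi g^-1)^-1]. *)
Lemma process_rshift_lower (kappa : R) (phi : G -> G) g Q :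
  0 < kappa ->
  (forall g f, in_L1 mu f -> \forall w \ae mu,
     kappa^-1 * `|f (act (phi g)^-1%g w)| <= `|T g f w|) ->
  rel_compact_borel Q ->
  \forall w \ae mu, `|F Q (act (phi g^-1)^-1 w)%g| <=
                    kappa * `|F (rshift_set Q g) w|.
Proof.
move=> k0 hT rQ.
have := process_equivariant hF g^-1%g rQ; rewrite invgK.
apply: filterS2 (hT g^-1%g _ (process_L1 hF rQ)) => w h1 h2.
by rewrite -ler_pdivrMl// -h2.
Qed.

(** Since the action preserves [mu], the product [m V * mu E] is the integral of
    the total weight of the pieces of [V] whose representative carries [w]
    into [E]; pointwise, the covering lemma and the packing majorant bound this
    weight. *)
Lemma transfer_inequality (C K kappa lambda : R) (phi : G -> G)
    (M N : nat) (V : set G) :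
  0 < C -> 0 <= K -> 0 < kappa -> 0 < lambda ->
  (forall n, (m (tempelman_hull U n) <= C%:E * m (U n))%E) ->
  (forall A, rel_compact_borel A -> (norm1 mu (F A) <= K%:E * m A)%E) ->
  (forall g f, in_L1 mu f -> \forall w \ae mu,
     kappa^-1 * `|f (act (phi g)^-1%g w)| <= `|T g f w|) ->
  compact V ->
  (mu (\bigcup_(j in [set j | (M <= j <= N)%N /\ (0 < m (U j))%E])
         exceedance lambda j) * m V <=
   (2 * C * kappa / lambda)%:E *
   (\int[mu]_w `|F0 V w| + K%:E * m (mulset (U N) V `\` V)))%E.
Proof.
move=> C0 K0 k0 l0 hC FK hT cV; set E := \bigcup_(j in _) _.
have mE : measurable E.
  by apply: bigcup_measurable => j _; exact: measurable_exceedance.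
have [k [g [v [gV v0 sv hS]]]] := vitali_translates hG hm hu N (@cU) U0 C0 hC cV.
pose tau i w := (act (phi (g i)^-1)^-1 w)%g.
pose Q (x : 'I_k * 'I_N.+1) := rshift_set (U x.2) (g x.1).
pose W := V `|` mulset (U N) V.
have cW : compact W by apply: compactU => //; exact: compact_mulset.
have rU j := compact_rcb hG (@cU j).
have Ufin j : m (U j) \is a fin_num by exact: rcb_fin_num (rU j).
have mQ x : measurable (Q x : set (borel G)).
  by apply: (compact_borel hG); exact: compact_rshift.
have QW x : Q x `<=` W.
  move=> _ [u Uu <-]; right; exists u; last by exists (g x.1).
  by apply: ndU Uu; rewrite -ltnS.
have [H [mH H0 intH packH]] := packing_majorant hF hF0 K0 FK
  (compact_rcb hG cW) (compact_borel hG cV) (@subsetUl _ _ _) mQ QW.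
have WV : W `\` V = mulset (U N) V `\` V by rewrite setDUl setDv set0U.
have c0 : 0 <= 2 * C * kappa / lambda by rewrite divr_ge0 ?mulr_ge0 ?ltW.
(* Every set of the family is compared at once, so that almost every [w] is
   good for whichever subfamily the covering lemma selects. *)
have pointwise : \forall w \ae mu,
    \sum_i v i * \1_(tau i @^-1` E) w <= 2 * C * kappa / lambda * H w.
  have : \forall w \ae mu, forall x : 'I_k * 'I_N.+1,
      `|F (U x.2) (tau x.1 w)| <= kappa * `|F (Q x) w|.
    by apply: filter_forall => x; exact: process_rshift_lower.
  apply: filterS2 packH => w packHw FQ.
  pose A := finset (fun x : 'I_k * 'I_N.+1 => [&& (M <= x.2)%N,
    (0 < m (U x.2))%E & lambda * fine (m (U x.2)) < `|F (U x.2) (tau x.1 w)|]).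
  have [|S [SA Sdisj Sv]] := hS A; first by move=> x; rewrite inE => /and3P[].
  apply: (@le_trans _ _ (\sum_(i | [exists j, (i, j) \in A]) v i)).
    rewrite [leRHS]big_mkcond; apply: ler_sum => i _; rewrite indicE.
    case: ifPn => [_|nA]; first by rewrite ler_piMr// lern1 leq_b1.
    rewrite memNset ?mulr0// => -[j /= [/andP[Mj jN] mUj] Ej].
    move/negP: nA; apply; apply/existsP; exists (Ordinal (jN : (j < N.+1)%N)).
    by rewrite inE /= Mj mUj.
  apply: (le_trans Sv).
  have -> : 2 * C * kappa / lambda * H w = 2 * C * (kappa * H w / lambda) by ring.
  rewrite ler_pM2l ?mulr_gt0// ler_pdivlMr// mulr_suml.
  apply: (@le_trans _ _ (\sum_(y in S) kappa * `|F (Q y) w|)); last first.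
    by rewrite -mulr_sumr ler_pM2l//; exact: packHw.
  apply: ler_sum => y /(fintype.subsetP SA); rewrite inE => /and3P[_ _ /ltW].
  by rewrite mulrC => /le_trans; apply.
have mtau i : measurable_fun setT (tau i) by exact: measurable_act.
have mtauE i : measurable (tau i @^-1` E) by rewrite -[_ @^-1` _]setTI; exact: mtau.
have -> : (mu E * m V = \int[mu]_w (\sum_i v i * \1_(tau i @^-1` E) w)%:E)%E.
  under eq_integral do rewrite -sumEFin.
  rewrite ge0_integral_sum//; last 2 first.
  - move=> i; apply/measurable_EFinP; apply: measurable_funM => //.
  - by move=> i w _; rewrite lee_fin mulr_ge0.
  transitivity (\sum_i (v i)%:E * mu E)%E; last first.
    apply: eq_bigr => i _; under eq_integral do rewrite EFinM.
    rewrite ge0_integralZl_EFin//; last exact/measurable_EFinP.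
    by rewrite integral_indic// setIT (action_preserving hact).
  rewrite -ge0_sume_distrl//; last by move=> i _; rewrite lee_fin.
  by rewrite sumEFin sv fineK 1?muleC//; exact: (rcb_fin_num hG hm (compact_rcb hG cV)).
rewrite -WV.
apply: (@le_trans _ _ (\int[mu]_w (2 * C * kappa / lambda * H w)%:E)%E).
  apply: ae_ge0_le_integral => //.
  - by move=> w _; rewrite lee_fin sumr_ge0// => i _; rewrite mulr_ge0.
  - apply/measurable_EFinP; apply: measurable_sum => i; exact: measurable_funM.
  - by move=> w _; rewrite lee_fin mulr_ge0.
  - by apply/measurable_EFinP; exact: measurable_funM.
  by apply: filterS pointwise => w h _; rewrite lee_fin.
under eq_integral do rewrite EFinM.
rewrite ge0_integralZl_EFin//; last 2 first.
- by move=> w _; rewrite lee_fin.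
- exact/measurable_EFinP.
by apply: lee_wpmul2l; rewrite ?lee_fin.
Qed.

End maximal.

(** * The maximal inequality *)

(** The conventions [a / 0 = +oo] for [0 < a] and [0 / 0 = 0] make clearing the
    denominator valid even when it vanishes. *)
Lemma lte_pdivrE {R : realType} (l a : R) (u : \bar R) : 0 < l -> 0 <= a ->
  (0 <= u)%E -> u \is a fin_num ->
  (l%:E < a%:E / u)%E = (l * fine u < a).
Proof.
move=> l0 a0; case: u => // u; rewrite lee_fin => u0 _ /=.
have [->|u_neq0] := eqVneq u 0.
  rewrite inve0 mulr0; have [->|a_neq0] := eqVneq a 0.
    by rewrite mul0e lte_fin ltxx ltNge ltW.
  have a_gt0 : 0 < a by rewrite lt_neqAle eq_sym a_neq0.
  by rewrite gt0_muley ?lte_fin// ltry a_gt0.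
by rewrite inver (negbTE u_neq0) -EFinM lte_fin ltr_pdivlMr// lt_neqAle eq_sym u_neq0.
Qed.

(** A Folner set of measure zero would be moved by any compact [L] of positive
    measure to a set of infinite relative size; hence the sets [U n] eventually
    have positive measure, and the ratio bound can be cleared of its
    denominator. *)
Lemma folner_step {R : realType} {G : topologicalGroupType}
    (m : {measure set (borel G) -> \bar R}) (U : nat -> set G) (K : set G)
    (M : nat) (e : R) :
  hausdorff_space G -> left_haar_measure m -> unimodular m ->
  weak_folner m U -> compact K -> K !=set0 -> 0 < e ->
  exists n, [/\ (M <= n)%N, (0 < m (U n))%E &
    (m (mulset K (U n) `\` U n) <= e%:E * m (U n))%E].
Proof.
move=> hG hm hu [cU hU] cK K0 e0.
have := haar_neq0 hm; rewrite (haar_inner_regular hm openT).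
move=> /ereal_sup_gt[_ [L [cL _] <-] mL].
have L0 : L !=set0.
  by apply/set0P/eqP => L0; rewrite L0 measure0 ltxx in mL.
have mLt (u : G) : m (rshift_set L u) = m L.
  by apply: hu; exact: compact_borel.
have near1 := hU L cL L0; have neare := hU K cK K0.
have lt1 : \forall n \near \oo, (m (U n `+` mulset L (U n)) / m (U n) < 1%:E)%E.
  by apply: (near1 (fun u => (u < 1%:E)%E)); apply: open_ereal_lt'; rewrite lte_fin.
have lte : \forall n \near \oo, (m (U n `+` mulset K (U n)) / m (U n) < e%:E)%E.
  by apply: (neare (fun u => (u < e%:E)%E)); apply: open_ereal_lt'; rewrite lte_fin.
have [n [[n1 ne] Mn]] := filter_ex (filterI (filterI lt1 lte) (nbhs_infty_ge M)).
have mU : measurable (U n : set (borel G)) by apply: compact_borel => //; case: (cU n).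
have mKU (L' : set G) : compact L' -> measurable (mulset L' (U n) : set (borel G)).
  by move=> cL'; apply: compact_borel => //; apply: compact_mulset => //; case: (cU n).
have Ufin : m (U n) \is a fin_num.
  by apply: (rcb_fin_num hG hm); apply: compact_rcb => //; case: (cU n).
have mUgt0 : (0 < m (U n))%E.
  rewrite lt0e measure_ge0 andbT; apply/eqP => mU0.
  have mLY : (0 < m (U n `+` mulset L (U n)))%E.
    apply: (lt_le_trans mL); have [u Uu] := (cU n).2; rewrite -(mLt u).
    rewrite -[leRHS]adde0 -mU0; apply: le_trans (measureU2 _ _ _) => //; last first.
      by apply: measurableU; apply: measurableD => //; exact: mKU.
    apply: le_measure; rewrite ?inE.
    - by apply: compact_borel => //; exact: compact_rshift.
    - apply: measurableU => //; apply: measurableU; apply: measurableD => //; exact: mKU.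
    move=> x Lx; have [xU|xU] := pselect (U n x); [by right|left; right; split=> //].
    by case: Lx => l Ll <-; exists l => //; exists u.
  by move: n1; rewrite mU0 inve0 gt0_muley.
exists n; split=> //.
apply: (@le_trans _ _ (m (U n `+` mulset K (U n)))).
  apply: le_measure; rewrite ?inE.
  - by apply: measurableD => //; exact: mKU.
  - by apply: measurableU; apply: measurableD => //; exact: mKU.
  by move=> x ?; right.
have u0 : 0 < fine (m (U n)) by rewrite fine_gt0// mUgt0 ltey_eq Ufin.
move: ne; rewrite -(fineK Ufin) inver gt_eqF// lte_pdivrMr// => /ltW.
by [].
Qed.

Theorem theorem7p9 (R : realType) (G : topologicalGroupType)
    (m : {measure set (borel G) -> \bar R})
    (U : nat -> set G)
    (d : measure_display) (Omega : measurableType d)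
    (mu : {sigma_finite_measure set Omega -> \bar R})
    (act : G -> Omega -> Omega)
    (Y : completeNormedModType R)
    (T : G -> (Omega -> Y) -> (Omega -> Y))
    (F : set G -> Omega -> Y)
    (F0 : set G -> Omega -> \bar R) :
  locally_compact [set: G] -> @second_countable G -> hausdorff_space G ->
  left_haar_measure m -> unimodular m -> amenable m ->
  weak_folner m U -> (forall j, U j `<=` U j.+1) -> tempelman m U ->
  measure_preserving_action mu act ->
  reflexive_space Y ->
  weakly_measurable_operators mu T ->
  norm_comparable mu act T ->
  bounded_additive_process m mu T F ->
  dominating_process mu F F0 ->
  exists2 gamma : R, 0 < gamma &
    forall (lambda : R) (M : nat), 0 < lambda ->
      (mu [set w | lambda%:E <
                   ereal_sup [set `|F (U j) w|%:E / m (U j)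
                             | j in [set j | (M <= j)%N]]]
       <= (gamma / lambda)%:E *
          ereal_sup [set (\int[mu]_w `|F0 (U j) w|) / m (U j)
                    | j in [set j | (M <= j)%N]])%E.
Proof.
move=> _ _ hG hm hu _ hfol hmon [C C0 hC] hact _ _ [kappa [phi [k1 _ hT]]] hF hF0.
have cU j : compact (U j) by case: (hfol.1 j).
have U0 j : U j !=set0 by case: (hfol.1 j).
have ndU : {homo U : i j / (i <= j)%N >-> i `<=` j}.
  exact: homo_leq (@subset_refl _) (@subset_trans _) hmon.
have k0 : 0 < kappa by exact: lt_le_trans k1.
have [K K0 FK] := process_norm1_le hG hm hF.
have hTlower g f : in_L1 mu f -> \forall w \ae mu,
    kappa^-1 * `|f (act (phi g)^-1%g w)| <= `|T g f w|.
  by move=> /(hT g); apply: filterS => w [].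
have rU j := compact_rcb hG (cU j).
have Ufin j : m (U j) \is a fin_num by exact: rcb_fin_num (rU j).
exists (2 * C * kappa) => [|lambda M l0]; first by rewrite !mulr_gt0.
set S := ereal_sup [set (_ / _)%E | j in _].
pose c := 2 * C * kappa / lambda.
have c0 : 0 < c by rewrite divr_gt0 ?mulr_gt0.
pose E N := \bigcup_(j in [set j | (M <= j <= N)%N /\ (0 < m (U j))%E])
  exceedance m U F lambda j.
have mexc := measurable_exceedance hG cU hF lambda.
have mE N : measurable (E N) by apply: bigcup_measurable.
have S0 : (0 <= S)%E.
  apply: (@le_trans _ _ ((\int[mu]_w `|F0 (U M) w|) / m (U M))%E).
    by rewrite mule_ge0 ?integral_ge0// inve_ge0.
  by apply: ereal_sup_ubound; exists M => //=.
have EN N : (mu (E N) <= c%:E * S)%E.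
  have [->|Soo] := eqVneq S +oo%E; first by rewrite gt0_muley// leey.
  have Sfin : S \is a fin_num by rewrite ge0_fin_numE// ltey.
  apply/lee_addgt0Pr => e e0.
  (* The boundary term, divided by [m (U n)], is at most [c * K] times this
     tolerance, hence smaller than [e]. *)
  have e'0 : 0 < e / (c * K + 1) by rewrite divr_gt0// ltr_wpDl// mulr_ge0// ltW.
  have [n [Mn mUn small]] := folner_step M hG hm hu hfol (cU N) (U0 N) e'0.
  have u0 : 0 < fine (m (U n)) by rewrite fine_gt0// mUn ltey_eq Ufin.
  have := transfer_inequality hG hm hu cU U0 ndU hact hF hF0 M N C0 K0 k0 l0 hC
    FK hTlower (cU n).
  rewrite -/(E N) -/c => transfer.
  have avg : (\int[mu]_w `|F0 (U n) w| <= S * m (U n))%E.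
    rewrite -(fineK (Ufin n)) -lee_pdivrMr//.
    apply: ereal_sup_ubound; exists n => //.
    by rewrite /= -[in LHS](fineK (Ufin n)) inver gt_eqF.
  rewrite -(lee_pmul2r (x := m (U n)))//; apply: (le_trans transfer).
  apply: (@le_trans _ _ (c%:E * (S * m (U n) +
      K%:E * ((e / (c * K + 1))%:E * m (U n))))%E).
    apply: lee_wpmul2l; first by rewrite lee_fin ltW.
    by apply: leeD => //; apply: lee_wpmul2l; rewrite ?lee_fin.
  rewrite -(fineK (Ufin n)) -(fineK Sfin) -!(EFinM, EFinD) lee_fin mulrDl.
  rewrite mulrDr [c * (fine S * _)]mulrA lerD2l.
  have -> : c * (K * (e / (c * K + 1) * fine (m (U n)))) =
      c * K / (c * K + 1) * (e * fine (m (U n))) by ring.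
  have cK1 : 0 < c * K + 1 by rewrite ltr_wpDl// mulr_ge0// ltW.
  have cK : c * K / (c * K + 1) <= 1 by rewrite ler_pdivrMr// mul1r lerDl.
  by rewrite ler_piMl// mulr_ge0// ltW.
(* A ratio with zero denominator exceeds [lambda] only where [F (U j)] is
   nonzero, and [F (U j)] vanishes almost everywhere if [U j] is null. *)
have null j : m (U j) = 0%E -> mu.-negligible (exceedance m U F lambda j).
  move=> mU0.
  have F0j : (\int[mu]_w `| (`|F (U j) w|%:E) | = 0)%E.
    under eq_integral do rewrite abse_EFin normr_id.
    by apply/eqP; rewrite eq_le integral_ge0// andbT (le_trans (FK _ (rU j)))// mU0 mule0.
  have mF : measurable_fun setT (fun w => `|F (U j) w|%:E).
    by apply/measurable_EFinP; exact: (process_norm_measurable hF (rU j)).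
  have /(ae_eq_integral_abs mu measurableT mF) := F0j.
  case=> N [mN N0 sub]; exists N; split=> // w; rewrite /exceedance /= mU0 mulr0.
  by move=> Fw; apply: sub => /= /(_ Logic.I) [F0w]; rewrite F0w ltxx in Fw.
have -> : [set w | lambda%:E < ereal_sup [set `|F (U j) w|%:E / m (U j)
      | j in [set j | (M <= j)%N]]]%E =
    \bigcup_(j in [set j | (M <= j)%N]) exceedance m U F lambda j.
  have excE w j : (lambda%:E < `|F (U j) w|%:E / m (U j))%E =
      (lambda * fine (m (U j)) < `|F (U j) w|) by exact: lte_pdivrE.
  apply/seteqP; split=> w.
    by move=> /ereal_sup_gt[_ [j Mj <-]]; rewrite excE => ?; exists j.
  move=> [j Mj]; rewrite /exceedance /= -excE => h.
  by apply: (lt_le_trans h); apply: ereal_sup_ubound; exists j.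
have mEE : measurable (\bigcup_N E N) by apply: bigcup_measurable.
have EE : (mu (\bigcup_N E N) <= c%:E * S)%E.
  have ndE : nondecreasing_seq E.
    move=> N N' NN'; apply/subsetPset => w [j [/andP[Mj jN] Uj] Ej]; exists j => //.
    by split=> //; rewrite Mj (leq_trans jN).
  have cvE : mu (E N) @[N --> \oo] --> mu (\bigcup_N E N).
    exact: nondecreasing_cvg_mu.
  rewrite -(cvg_lim _ cvE)//; apply: lime_le; first by apply/cvg_ex; eexists; exact: cvE.
  exact: nearW.
pose Z := \bigcup_j (if m (U j) == 0%E then exceedance m U F lambda j else set0).
have mZ : measurable Z.
  by apply: bigcup_measurable => j _; case: ifP.
have Z0 : mu Z = 0%E.
  apply: measure_negligible => //; apply: negligible_bigcup => j.
  by case: ifPn => [/eqP/null//|_]; exact: negligible_set0.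
apply: (le_trans _ EE); rewrite -[leRHS]adde0 -Z0.
apply: le_trans (measureU2 _ mEE mZ); apply: le_measure; rewrite ?inE.
- by apply: bigcup_measurable.
- exact: measurableU.
move=> w [j Mj Ej]; have [Uj0|Uj0] := eqVneq (m (U j)) 0%E.
  by right; exists j => //; rewrite Uj0 eqxx.
left; exists j => //; exists j => //; split; first by rewrite /= Mj leqnn.
by rewrite lt0e Uj0 measure_ge0.
Qed.
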